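(* Let $n\in\{1,2,\dots\}$. Then for all $\delta\in(n,n+1)$ $$\frac{(n+1-\delta)\,\delta}{\delta-n}+(n+1-\delta)<u_n(\delta)<\frac{\delta}{\delta-n}.$$
   Context: For $n\in\{1,2,\dots\}$ and $\delta\in(n,n+1)$, $u_n(\delta)$ denotes the unique positive solution $u$ of $$e^{-u}=1-\frac{u^1}{1!}+\dots+(-1)^{n-1}\frac{u^{n-1}}{(n-1)!}+(-1)^n\frac{\delta u^n}{n!\,(u+\delta)}.$$ *)

(* Defs.v *)
From Stdlib Require Export Reals Factorial ClassicalEpsilon.
Open Scope R_scope.

(* Since [1 <= n], the sum [sum_f_R0 _ (n - 1)] runs over k = 0, ..., n-1. *)
Definition positive_solution (n : nat) (delta u : R) : Prop :=
  0 < u /\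
  exp (- u) =
    sum_f_R0 (fun k => (-1) ^ k * (u ^ k / INR (fact k))) (n - 1)
    + (-1) ^ n * ((delta * u ^ n) / (INR (fact n) * (u + delta))).

(* Definite description: [unique P u] says that u is the only real satisfying P.
   The value is unspecified unless a unique positive solution exists, so any
   claim about it for given n and delta rests on existence and uniqueness. *)
Definition u_ (n : nat) (delta : R) : R :=
  epsilon (inhabits 0) (unique (positive_solution n delta)).

(* Main.v *)
Require Import Defs.
From Stdlib Require Import Reals.
From Stdlib Require Import Ranalysis5 Lra Lia.
From Coquelicot Require Import Coquelicot.
Open Scope R_scope.

(** Write [n = m + 1], let [S] be the Taylor polynomial of [exp (- u)] of degree
    [m], and put

      [E u = n! (-1)^n (1 - exp u * S u)],

    the Taylor remainder of [exp (- u)] made positive and multiplied by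
    [n! exp u].  The equation defining [u_n delta] becomes

      [E u = exp u * delta * u^n / (u + delta)],

    and the point of this scaling is that [E] has the elementary derivative
    [n u^(n-1) exp u], since all but one term of [(exp u * S u)'] cancel.  When
    [E] is compared with [exp u * u^n * phi u], where [phi] is rational, the
    derivative of the difference is therefore [exp u * u^(n-1)] times a rational
    function, whose sign is a matter of algebra.  Three choices of [phi] prove
    the theorem.

    - For fixed [delta] and [phi u = delta / (u + delta)], the difference
      vanishes at [0], increases up to
      [(n + 1 - delta) * delta / (delta - n)] and decreases afterwards.  It thus
      has at most one positive zero, beyond that point, and any two points there
      where it is positive and then negative enclose this zero
      ([u_bounds_of_gap_signs]).  The two claimed bounds are such points.

    - At the upper bound [u = delta / (delta - n)] one has
      [delta / (u + delta) = n / (u + n - 1)].  The sign there follows from the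
      inequality [E u < exp u * n u^n / (u + n - 1)], which holds for every
      [u > 0] ([gap_self_pred_neg]).

    - The lower bound is likewise an algebraic function of [delta], and
      eliminating [delta] would give a [phi] with a square root.  The curve is
      instead parametrized by [s = delta - n], from [s = 1] (where [u = 0])
      down to [s = 0]; the difference then has a derivative of constant sign
      because of a perfect square ([is_derive_lower_gap],
      [lower_gap_pos]). *)

(** * Monotonicity from the sign of the derivative *)

Lemma is_derive_pos_lt (f f' : R -> R) (a b : R) :
  a < b ->
  (forall x, a <= x <= b -> is_derive f x (f' x)) ->
  (forall x, a < x < b -> 0 < f' x) ->
  f a < f b.
Proof.
  intros Hab Hf Hpos.
  destruct (MVT_cor2 f f' a b Hab) as [c [Hc Hcab]].
  - intros c Hc. apply is_derive_Reals, Hf, Hc.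
  - specialize (Hpos c Hcab). nra.
Qed.

Lemma is_derive_neg_lt (f f' : R -> R) (a b : R) :
  a < b ->
  (forall x, a <= x <= b -> is_derive f x (f' x)) ->
  (forall x, a < x < b -> f' x < 0) ->
  f b < f a.
Proof.
  intros Hab Hf Hneg.
  destruct (MVT_cor2 f f' a b Hab) as [c [Hc Hcab]].
  - intros c Hc. apply is_derive_Reals, Hf, Hc.
  - specialize (Hneg c Hcab). nra.
Qed.

(** * The scaled Taylor remainder of [exp (- u)] *)

Definition exp_opp_taylor (m : nat) (u : R) : R :=
  sum_f_R0 (fun k => (-1) ^ k * (u ^ k / INR (fact k))) m.

Lemma INR_fact_S (m : nat) : INR (fact (S m)) = INR (S m) * INR (fact m).
Proof. rewrite <- mult_INR. reflexivity. Qed.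

Lemma pow_m1_sqr (m : nat) : (-1) ^ m * (-1) ^ m = 1.
Proof. rewrite <- Rpow_mult_distr. replace (-1 * -1) with 1 by ring. apply pow1. Qed.

(** The polynomial [P] satisfies [P' + P = ] its last term, because
    differentiation shifts the terms by one and changes their sign. *)
Lemma is_derive_exp_opp_taylor (m : nat) (u : R) :
  is_derive (fun u => exp u * exp_opp_taylor m u) u
    (exp u * ((-1) ^ m * (u ^ m / INR (fact m)))).
Proof.
  induction m as [|m IH].
  - unfold exp_opp_taylor; simpl. auto_derive; [easy | field].
  - apply (is_derive_ext
      (fun u => exp u * exp_opp_taylor m u
                + exp u * ((-1) ^ S m * (u ^ S m / INR (fact (S m)))))).
    { intros t. unfold exp_opp_taylor. rewrite tech5. symmetry. apply Rmult_plus_distr_l. }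
    pose proof (INR_fact_neq_0 m) as Hf.
    pose proof (not_0_INR (S m) (Nat.neq_succ_0 m)) as HN.
    replace (exp u * ((-1) ^ S m * (u ^ S m / INR (fact (S m)))))
      with (exp u * ((-1) ^ m * (u ^ m / INR (fact m)))
            + exp u * ((-1) ^ S m * ((u ^ S m + INR (S m) * u ^ m) / INR (fact (S m))))).
    2: { rewrite INR_fact_S. change ((-1) ^ S m) with (-1 * (-1) ^ m). field. auto. }
    apply (is_derive_plus (V := R_NormedModule)
      (fun u => exp u * exp_opp_taylor m u)); [exact IH |].
    rewrite INR_fact_S.
    auto_derive; [easy |].
    change (pred (S m)) with m. change (u ^ S m) with (u * u ^ m).
    change ((-1) ^ S m) with (-1 * (-1) ^ m).
    change (match m with 0%nat => 1 | S _ => INR m + 1 end) with (INR (S m)).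
    field. auto.
Qed.

(** In integral form this is [n * int_0^u t^(n-1) exp t dt] with [n = m + 1]; the
    closed form is the one that occurs in the equation for [u_n]. *)
Definition scaled_remainder (m : nat) (u : R) : R :=
  INR (fact (S m)) * (-1) ^ S m * (1 - exp u * exp_opp_taylor m u).

Lemma is_derive_scaled_remainder (m : nat) (u : R) :
  is_derive (scaled_remainder m) u (INR (S m) * (exp u * u ^ m)).
Proof.
  replace (INR (S m) * (exp u * u ^ m))
    with (INR (fact (S m)) * (-1) ^ S m
          * (0 - exp u * ((-1) ^ m * (u ^ m / INR (fact m))))).
  - apply (is_derive_scal (fun u => 1 - exp u * exp_opp_taylor m u)).
    apply (is_derive_minus (V := R_NormedModule) (fun _ => 1)).
    + apply @is_derive_const.
    + apply is_derive_exp_opp_taylor.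
  - rewrite INR_fact_S. change ((-1) ^ S m) with (-1 * (-1) ^ m).
    transitivity (INR (S m) * (exp u * u ^ m) * ((-1) ^ m * (-1) ^ m)).
    + field. apply INR_fact_neq_0.
    + rewrite pow_m1_sqr. ring.
Qed.

Lemma scaled_remainder_0 (m : nat) : scaled_remainder m 0 = 0.
Proof.
  assert (H : exp_opp_taylor m 0 = 1).
  { unfold exp_opp_taylor. induction m as [|m IH].
    - simpl. field.
    - rewrite tech5, IH, pow_i by lia. unfold Rdiv. ring. }
  unfold scaled_remainder. rewrite H, exp_0. ring.
Qed.

(** * Comparing the remainder with a rational function *)

(** The pole [- d] and the coefficient [c] are kept independent: [c = d = delta]
    is the equation for [u_n delta], while [c = n], [d = n - 1] gives the upper
    bound. *)
Definition gap (m : nat) (c d u : R) : R :=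
  scaled_remainder m u - exp u * (c * u ^ S m / (u + d)).

Lemma is_derive_gap (m : nat) (c d u : R) :
  u + d <> 0 ->
  is_derive (gap m c d) u
    (exp u * u ^ m / (u + d) ^ 2
     * (INR (S m) * (u + d) ^ 2 - c * (u + d) * (u + INR (S m)) + c * u)).
Proof.
  intros Hud. unfold gap.
  replace (exp u * u ^ m / (u + d) ^ 2
     * (INR (S m) * (u + d) ^ 2 - c * (u + d) * (u + INR (S m)) + c * u))
    with (INR (S m) * (exp u * u ^ m)
          - exp u * (c * u ^ m * ((u + INR (S m)) * (u + d) - u) / (u + d) ^ 2))
    by (field; exact Hud).
  apply (is_derive_minus (V := R_NormedModule) (scaled_remainder m)).
  - apply is_derive_scaled_remainder.
  - auto_derive; [exact Hud |].
    change (pred (S m)) with m. change (u ^ S m) with (u * u ^ m).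
    change ((-1) ^ S m) with (-1 * (-1) ^ m).
    change (match m with 0%nat => 1 | S _ => INR m + 1 end) with (INR (S m)).
    field. exact Hud.
Qed.

Lemma positive_solution_iff_gap (m : nat) (delta u : R) :
  0 < delta ->
  positive_solution (S m) delta u <-> 0 < u /\ gap m delta delta u = 0.
Proof.
  intros Hd. unfold positive_solution.
  replace (S m - 1)%nat with m by lia.
  fold (exp_opp_taylor m u).
  split; intros [Hu H]; (split; [exact Hu |]).
  all: pose proof (INR_fact_neq_0 (S m)) as Hf.
  all: pose proof (pow_m1_sqr (S m)) as Hs.
  all: assert (Hexp : exp u * exp (- u) = 1)
    by (rewrite <- exp_plus, Rplus_opp_r; apply exp_0).
  all: assert (Hgap : gap m delta delta u
    = INR (fact (S m)) * (-1) ^ S m * exp u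
      * (exp (- u) - (exp_opp_taylor m u
         + (-1) ^ S m * (delta * u ^ S m / (INR (fact (S m)) * (u + delta)))))).
  1, 3: unfold gap, scaled_remainder; rewrite <- Hexp;
    transitivity (INR (fact (S m)) * (-1) ^ S m
        * (exp u * exp (- u) - exp u * exp_opp_taylor m u)
      - exp u * (delta * u ^ S m / (u + delta)) * ((-1) ^ S m * (-1) ^ S m));
    [rewrite Hs; ring | field; lra].
  - rewrite Hgap, H. ring.
  - rewrite Hgap in H. apply Rminus_diag_uniq.
    apply Rmult_integral in H. destruct H as [H | H]; [exfalso | exact H].
    pose proof (exp_pos u).
    apply Rmult_integral in H. destruct H as [H | H]; [| lra].
    apply Rmult_integral in H. destruct H as [H | H]; [auto |].
    rewrite H in Hs. lra.
Qed.

Lemma gap_0 (m : nat) (c d : R) : gap m c d 0 = 0.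
Proof.
  unfold gap. rewrite scaled_remainder_0, pow_i by lia. unfold Rdiv. ring.
Qed.

(** * Locating the positive solution *)

Definition turning_point (m : nat) (delta : R) : R :=
  (INR (S m) + 1 - delta) * delta / (delta - INR (S m)).

Lemma turning_point_pos (m : nat) (delta : R) :
  INR (S m) < delta < INR (S m) + 1 ->
  0 < turning_point m delta.
Proof.
  intros Hdelta.
  pose proof (pos_INR (S m)). unfold turning_point.
  apply Rdiv_lt_0_compat; nra.
Qed.

(** For [c = d = delta] the quadratic factor of [is_derive_gap] has no constant
    term, hence a single nonzero root. *)
Lemma is_derive_gap_delta (m : nat) (delta u : R) :
  INR (S m) < delta < INR (S m) + 1 ->
  0 <= u ->
  is_derive (gap m delta delta) u
    (exp u * u ^ m / (u + delta) ^ 2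
     * (u * (delta - INR (S m)) * (turning_point m delta - u))).
Proof.
  intros Hdelta Hu. pose proof (pos_INR (S m)).
  replace (u * (delta - INR (S m)) * (turning_point m delta - u))
    with (INR (S m) * (u + delta) ^ 2
          - delta * (u + delta) * (u + INR (S m)) + delta * u)
    by (unfold turning_point; field; lra).
  apply is_derive_gap. lra.
Qed.

Lemma gap_derivative_factor_pos (m : nat) (delta u : R) :
  0 < delta ->
  0 < u -> 0 < exp u * u ^ m / (u + delta) ^ 2.
Proof.
  intros Hdelta Hu.
  apply Rdiv_lt_0_compat.
  - apply Rmult_lt_0_compat; [apply exp_pos | apply pow_lt, Hu].
  - apply pow_lt. lra.
Qed.

Lemma gap_pos_before_turning (m : nat) (delta u : R) :
  INR (S m) < delta < INR (S m) + 1 ->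
  0 < u <= turning_point m delta -> 0 < gap m delta delta u.
Proof.
  intros Hdelta Hu. rewrite <- (gap_0 m delta delta).
  eapply is_derive_pos_lt; [lra | |].
  - intros x Hx. apply is_derive_gap_delta; lra.
  - intros x Hx. pose proof (pos_INR (S m)).
    pose proof (gap_derivative_factor_pos m delta x ltac:(lra) ltac:(lra)).
    cbv beta. apply Rmult_lt_0_compat; [assumption |].
    apply Rmult_lt_0_compat; [apply Rmult_lt_0_compat |]; lra.
Qed.

Lemma gap_decreasing_after_turning (m : nat) (delta u v : R) :
  INR (S m) < delta < INR (S m) + 1 ->
  turning_point m delta <= u < v -> gap m delta delta v < gap m delta delta u.
Proof.
  intros Hdelta Huv. pose proof (turning_point_pos m delta Hdelta).
  eapply is_derive_neg_lt; [lra | |].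
  - intros x Hx. apply is_derive_gap_delta; lra.
  - intros x Hx. pose proof (pos_INR (S m)).
    pose proof (gap_derivative_factor_pos m delta x ltac:(lra) ltac:(lra)).
    cbv beta. rewrite <- (Rmult_0_r (exp x * x ^ m / (x + delta) ^ 2)).
    apply Rmult_lt_compat_l; [assumption |].
    assert (0 < x * (delta - INR (S m))) by (apply Rmult_lt_0_compat; lra).
    nra.
Qed.

(** A zero exists between [lo] and [hi] by the intermediate value theorem.  It is
    the only positive one: there is none up to the turning point, and the gap is
    strictly decreasing after it.  Uniqueness is what gives [u_] a specified
    value. *)
Lemma u_bounds_of_gap_signs (m : nat) (delta lo hi : R) :
  INR (S m) < delta < INR (S m) + 1 ->
  turning_point m delta < lo < hi ->
  0 < gap m delta delta lo -> gap m delta delta hi < 0 ->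
  lo < u_ (S m) delta < hi.
Proof.
  intros Hdelta Hlohi Hlo Hhi.
  pose proof (turning_point_pos m delta Hdelta) as Htp. pose proof (pos_INR (S m)).
  destruct (IVT_interv (fun u => - gap m delta delta u) lo hi) as [r [Hr Hr0]];
    [ | lra | lra | lra |].
  - intros u Hu. apply continuity_pt_opp, continuity_pt_filterlim.
    apply (ex_derive_continuous (V := R_NormedModule) (gap m delta delta)).
    eexists. apply is_derive_gap_delta; lra.
  - assert (Hrsol : unique (positive_solution (S m) delta) r).
    { split; [apply positive_solution_iff_gap; lra |].
      intros v Hv. apply positive_solution_iff_gap in Hv; [| lra].
      destruct (Rle_or_lt v (turning_point m delta)) as [Hle | Hgt].
      - pose proof (gap_pos_before_turning m delta v Hdelta ltac:(lra)). lra.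
      - destruct (Rtotal_order r v) as [Hrv | [Hrv | Hrv]]; [| exact Hrv |].
        + pose proof (gap_decreasing_after_turning m delta r v Hdelta ltac:(lra)). lra.
        + pose proof (gap_decreasing_after_turning m delta v r Hdelta ltac:(lra)). lra. }
    assert (Hu : unique (positive_solution (S m) delta) (u_ (S m) delta))
      by (unfold u_; apply epsilon_spec; exists r; exact Hrsol).
    rewrite <- (proj2 Hrsol _ (proj1 Hu)).
    destruct (Req_dec r lo) as [-> | Hne]; [lra |].
    destruct (Req_dec r hi) as [-> | Hne']; lra.
Qed.

(** * The upper bound *)

(** With [n = m + 1], [c = n] and [d = n - 1] the quadratic factor of the
    derivative collapses to the constant [n (1 - n)], negative as soon as
    [n > 1].  For [n = 1] the pole is at [0], and the gap is the constant [-1]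
    on the positive axis instead of a function starting from [0]. *)
Lemma gap_self_pred_neg (m : nat) (u : R) :
  0 < u -> gap m (INR (S m)) (INR m) u < 0.
Proof.
  intros Hu. destruct m as [|m].
  - unfold gap, scaled_remainder, exp_opp_taylor. simpl.
    replace (1 * (u * 1) / (u + 0)) with 1 by (field; lra). lra.
  - rewrite <- (gap_0 (S m) (INR (S (S m))) (INR (S m))).
    assert (Hm : 0 < INR (S m)) by (apply lt_0_INR; lia).
    eapply is_derive_neg_lt; [exact Hu | |].
    + intros x Hx. apply is_derive_gap. lra.
    + intros x Hx. cbv beta. rewrite (S_INR (S m)).
      assert (0 < exp x * x ^ S m / (x + INR (S m)) ^ 2).
      { apply Rdiv_lt_0_compat; [| apply pow_lt; lra].
        apply Rmult_lt_0_compat; [apply exp_pos | apply pow_lt; lra]. }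
      rewrite <- (Rmult_0_r (exp x * x ^ S m / (x + INR (S m)) ^ 2)).
      apply Rmult_lt_compat_l; [assumption |].
      nra.
Qed.

(** * The lower bound *)

(** The lower bound, and the value of [delta / (u + delta)] there, as functions of
    [s = delta - n]. *)
Definition lower_arg (N s : R) : R := (1 - s) * (N + 2 * s) / s.

Definition lower_ratio (N s : R) : R := s * (N + s) / (N + 2 * s - s ^ 2).

Lemma is_derive_lower_arg (N s : R) :
  s <> 0 -> is_derive (lower_arg N) s (- (N + 2 * s ^ 2) / s ^ 2).
Proof.
  intros Hs. unfold lower_arg. auto_derive; [exact Hs | field; exact Hs].
Qed.

Definition lower_gap (m : nat) (s : R) : R :=
  let N := INR (S m) in
  let u := lower_arg N s in
  scaled_remainder m u - exp u * (lower_ratio N s * u ^ S m).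

(** After division by [exp u * u^n], the terms that come from the variation of
    [u] add up to [(N + 2 s^2) / D] with [D = N + 2 s - s^2], and the variation
    of [lower_ratio] contributes
    [- (N^2 + 2 N s + 2 s^2 + N s^2) / D^2].  They nearly cancel:
    [N^2 + 2 N s + 2 s^2 + N s^2 - D (N + 2 s^2) = 2 s^2 (1 - s)^2]. *)
Lemma is_derive_lower_gap (m : nat) (s : R) :
  0 < s <= 1 ->
  let N := INR (S m) in
  let u := lower_arg N s in
  is_derive (lower_gap m) s
    (- (exp u * u ^ S m * (2 * s ^ 2 * (1 - s) ^ 2) / (N + 2 * s - s ^ 2) ^ 2)).
Proof.
  intros Hs N u.
  assert (HN : 0 < N) by (apply lt_0_INR; lia).
  assert (HD : 0 < N + 2 * s - s ^ 2) by nra.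
  pose proof (is_derive_lower_arg N s ltac:(lra)) as Hu.
  set (u' := - (N + 2 * s ^ 2) / s ^ 2) in Hu.
  set (r' := (N ^ 2 + 2 * N * s + 2 * s ^ 2 + N * s ^ 2) / (N + 2 * s - s ^ 2) ^ 2).
  assert (Hr : is_derive (lower_ratio N) s r').
  { unfold lower_ratio, r'. auto_derive; [lra | field; lra]. }
  unfold lower_gap. fold N.
  replace (- (exp u * u ^ S m * (2 * s ^ 2 * (1 - s) ^ 2) / (N + 2 * s - s ^ 2) ^ 2))
    with (u' * (N * (exp u * u ^ m))
          - (u' * exp u * (lower_ratio N s * u ^ S m)
             + exp u * (r' * u ^ S m + lower_ratio N s * (N * u' * u ^ m)))).
  - apply (is_derive_minus (V := R_NormedModule)
      (fun s => scaled_remainder m (lower_arg N s))).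
    + apply (is_derive_comp (V := R_NormedModule) (scaled_remainder m) (lower_arg N));
        [apply is_derive_scaled_remainder | exact Hu].
    + auto_derive.
      * repeat split; try (eexists; eassumption).
      * change (pred (S m)) with m.
        replace (Derive (fun x => lower_arg N x) s) with u'
          by (symmetry; apply is_derive_unique, Hu).
        replace (Derive (fun x => lower_ratio N x) s) with r'
          by (symmetry; apply is_derive_unique, Hr).
        fold u.
        change (match m with 0%nat => 1 | S _ => INR m + 1 end) with (INR (S m)).
        fold N. change (u ^ S m) with (u * u ^ m). ring.
  - change (u ^ S m) with (u * u ^ m).
    transitivity (exp u * u ^ m *
      (u' * (N * (1 - lower_ratio N s) - u * lower_ratio N s) - r' * u)); [ring |].
    transitivity (exp u * u ^ m *
      - (u * (2 * s ^ 2 * (1 - s) ^ 2) / (N + 2 * s - s ^ 2) ^ 2)).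
    2: { field. lra. }
    f_equal. unfold u, u', r', lower_arg, lower_ratio. field. lra.
Qed.

Lemma lower_gap_pos (m : nat) (s : R) : 0 < s < 1 -> 0 < lower_gap m s.
Proof.
  intros Hs.
  assert (HN : 0 < INR (S m)) by (apply lt_0_INR; lia).
  assert (H1 : lower_gap m 1 = 0).
  { unfold lower_gap.
    replace (lower_arg (INR (S m)) 1) with 0 by (unfold lower_arg; field).
    rewrite scaled_remainder_0, pow_i by lia. ring. }
  rewrite <- H1.
  eapply is_derive_neg_lt; [lra | |].
  - intros x Hx. apply is_derive_lower_gap. lra.
  - intros x Hx. cbv beta.
    apply Ropp_lt_gt_0_contravar, Rlt_gt.
    apply Rdiv_lt_0_compat; [| apply pow_lt; nra].
    apply Rmult_lt_0_compat.
    + apply Rmult_lt_0_compat; [apply exp_pos | apply pow_lt].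
      unfold lower_arg. apply Rdiv_lt_0_compat; [apply Rmult_lt_0_compat |]; lra.
    + apply Rmult_lt_0_compat; [| apply pow_lt; lra].
      apply Rmult_lt_0_compat; [lra | apply pow_lt; lra].
Qed.

Theorem proposition17 (n : nat) (hn : (1 <= n)%nat) (delta : R)
  (hdelta : INR n < delta < INR n + 1) :
  (INR n + 1 - delta) * delta / (delta - INR n) + (INR n + 1 - delta)
    < u_ n delta
  /\ u_ n delta < delta / (delta - INR n).
Proof.
  destruct n as [|m]; [lia |].
  pose proof (S_INR m) as HSm.
  pose proof (pos_INR m) as Hm.
  set (lo := (INR (S m) + 1 - delta) * delta / (delta - INR (S m))
             + (INR (S m) + 1 - delta)).
  set (hi := delta / (delta - INR (S m))).
  apply (u_bounds_of_gap_signs m delta lo hi hdelta).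
  - split; [unfold lo, turning_point; lra |].
    apply Rminus_lt_0.
    replace (hi - lo) with (INR m + 2 * (delta - INR (S m)))
      by (unfold hi, lo; rewrite HSm; field; lra).
    lra.
  - assert (Hlo : lo = lower_arg (INR (S m)) (delta - INR (S m)))
      by (unfold lo, lower_arg; field; lra).
    replace (gap m delta delta lo) with (lower_gap m (delta - INR (S m))).
    { apply lower_gap_pos. lra. }
    unfold gap, lower_gap. rewrite <- Hlo. do 2 f_equal.
    replace (lower_ratio (INR (S m)) (delta - INR (S m))) with (delta / (lo + delta)).
    + unfold Rdiv. ring.
    + unfold lower_ratio, lo. field.
      repeat split; nra.
  - assert (Hhi : 0 < hi) by (apply Rdiv_lt_0_compat; lra).
    replace (gap m delta delta hi) with (gap m (INR (S m)) (INR m) hi).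
    { apply gap_self_pred_neg, Hhi. }
    unfold gap. do 2 f_equal.
    replace (INR m) with (INR (S m) - 1) by lra.
    unfold hi at 2 4. field.
    repeat split; nra.
Qed.
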